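(* Let $q$ be a prime power. For any integers $m,k\geq 2$, any $t\ge 1$ and any positive integers $n_2,\ldots,n_t$ with $n_i\le mk$, there exists a minimal nondegenerate sum-rank metric code with parameters $[(2k+m-2,n_2,\ldots,n_t),k]_{q^m/q}$.
   Context: For a tuple of positive integers $\mathbf{n}=(n_1,\ldots,n_t)$ (here not required to be ordered), put $\mathbb{F}_{q^m}^{\mathbf{n}}=\bigoplus_{i=1}^t\mathbb{F}_{q^m}^{n_i}$. The rank of $v=(v_1,\ldots,v_n)\in\mathbb{F}_{q^m}^n$ is $\mathrm{rk}(v)=\dim_{\mathbb{F}_q}\langle v_1,\ldots,v_n\rangle_{\mathbb{F}_q}$; the sum-rank weight of $x=(x_1,\ldots,x_t)$ is $w(x)=\sum_{i=1}^t\mathrm{rk}(x_i)$, and the sum-rank distance is $d(x,y)=w(x-y)$. An $[\mathbf{n},k]_{q^m/q}$ (sum-rank metric) code is a $k$-dimensional $\mathbb{F}_{q^m}$-subspace $\mathcal{C}$ of $\mathbb{F}_{q^m}^{\mathbf{n}}$ with this distance. A generator matrix is $G=(G_1|\cdots|G_t)$, $G_i\in\mathbb{F}_{q^m}^{k\times n_i}$, whose rows form a basis of $\mathcal{C}$. $\mathcal{C}$ is nondegenerate if for each $i$ the columns of $G_i$ are $\mathbb{F}_q$-linearly independent. Support: fix an $\mathbb{F}_q$-basis of $\mathbb{F}_{q^m}$; for $x_i\in\mathbb{F}_{q^m}^{n_i}$ let $\Gamma(x_i)\in\mathbb{F}_q^{n_i\times m}$ be the matrix whose $j$-th row consists of the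 coordinates of the $j$-th entry of $x_i$. The sum-rank support of $x$ is the tuple $(\mathrm{colsp}\,\Gamma(x_1),\ldots,\mathrm{colsp}\,\Gamma(x_t))$ of $\mathbb{F}_q$-column spaces (independent of the basis); inclusion of supports is componentwise. A codeword $c\in\mathcal{C}$ is minimal if every $c'\in\mathcal{C}$ whose support is contained in the support of $c$ satisfies $c'=\lambda c$ for some $\lambda\in\mathbb{F}_{q^m}$. $\mathcal{C}$ is minimal if all its codewords are minimal. *)

(* Defs.v *)
From HB Require Import structures.
From mathcomp Require Import all_boot all_order all_algebra all_field.

Set Implicit Arguments.
Unset Strict Implicit.
Unset Printing Implicit Defensive.

Import GRing.Theory.
Local Open Scope ring_scope.

(* F stands for F_q and L for F_(q^m), with m = \dim {:L}. The space           *)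
(* L^(n_1) + ... + L^(n_t) is the space of row vectors of length \sum_i n i,   *)
(* the i-th block of x being submxrow x i. Blocks are numbered from 0.         *)

Section SumRank.

Variables (F : finFieldType) (L : fieldExtType F).

Section Support.

Variable len : nat.

Definition Gamma (x : 'rV[L]_len) : 'M[F]_(len, \dim {:L}) :=
  \matrix_(j, l) coord (vbasis {:L}) l (x 0 j).

Definition colsp p (A : 'M[F]_(len, p)) : {vspace 'cV[F]_len} :=
  <<[seq col l A | l : 'I_p]>>%VS.

End Support.

Variables (t : nat) (n : 'I_t -> nat).

Notation space := 'rV[L]_(\sum_i n i).

Definition srk_supp (x : space) (i : 'I_t) : {vspace 'cV[F]_(n i)} :=
  colsp (Gamma (submxrow x i)).

Definition srk_supp_le (x y : space) : Prop :=
  forall i, (srk_supp x i <= srk_supp y i)%VS.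

Definition generator_matrix (C : {vspace space}) k
    (G : 'M[L]_(k, \sum_i n i)) : bool :=
  basis_of C [seq row r G | r : 'I_k].

(* A column is stored as a finite function 'I_k -> L because that type is an   *)
(* F-vector space, whereas 'cV[L]_k is only an L-vector space.                 *)
Definition column k len (A : 'M[L]_(k, len)) (j : 'I_len) : {ffun 'I_k -> L} :=
  [ffun r => A r j].

Definition columns_free k len (A : 'M[L]_(k, len)) : bool :=
  @free F _ [seq column A j | j : 'I_len].

(* Two generator matrices differ by an invertible left factor, which preserves *)
(* F-independence of columns, so the choice of G is irrelevant.                *)
Definition srk_nondegenerate (C : {vspace space}) : Prop :=
  exists2 G : 'M[L]_(\dim C, \sum_i n i),
    generator_matrix C G & forall i, columns_free (submxrow G i).

Definition minimal_codeword (C : {vspace space}) (c : space) : Prop :=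
  forall c' : space, c' \in C -> srk_supp_le c' c ->
  exists lambda : L, c' = lambda *: c.

Definition minimal_code (C : {vspace space}) : Prop :=
  forall c : space, c \in C -> minimal_codeword C c.

End SumRank.

(* Main.v *)
Require Import Defs.
From HB Require Import structures.
From mathcomp Require Import all_boot all_order all_algebra all_field.
From mathcomp Require Import zify.

(* If the support of c' lies in that of c, then on every block c' = phi(c)     *)
(* entrywise for an F-linear phi : L -> L. Only the first block matters: its   *)
(* generator matrix G must be such that y G = phi(x G) forces y to be a        *)
(* multiple of x. Put Q = #|L|, so that there are Q^m maps phi. For fixed      *)
(* independent x and y, a random G admits such a phi with probability at most  *)
(* Q^(m - N), N = 2k + m - 2. A bad pair (x, y) for G yields (Q - 1)^2 Q bad   *)
(* pairs (l x, u y + v x), and Q^(2k) Q^(m - N) = Q^2 < (Q - 1)^2 Q, so some G *)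
(* has no bad pair. The property survives adjoining vectors to the F-span of   *)
(* the columns, whence a G with F-independent columns; the other blocks are    *)
(* arbitrary F-independent columns.                                            *)

Set Implicit Arguments.
Unset Strict Implicit.
Unset Printing Implicit Defensive.

Import GRing.Theory passmx.
Local Open Scope ring_scope.

(** Replacing [G] by [G + w *m z] then fixes [x *m G] and shifts [y *m G] by [z]. A nonzero entry of
    [y *m cokermx x] selects the column that becomes [w]. *)
Lemma sub_rV_separate (F : fieldType) p (x y : 'rV[F]_p) : ~~ (y <= x)%MS ->
  exists2 w : 'cV[F]_p, x *m w = 0 & y *m w = 1%:M.
Proof.
rewrite submxE => /rV0Pn[j hj]; set c := (y *m cokermx x) 0 j in hj *.
exists (c^-1 *: col j (cokermx x)).
  by rewrite -scalemxAr colE mulmxA mulmx_coker mul0mx scaler0.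
apply/matrixP=> a b; rewrite !ord1 -scalemxAr colE mulmxA -colE.
by rewrite [LHS]mxE [col _ _ _ _]mxE [RHS]mxE mulVf.
Qed.

(** * Counting matrices that admit a bad pair *)

Section Counting.

Variables (K : finFieldType) (I : finType) (ev : I -> K -> K) (k N : nat).

(** Later [I] is ['End(L)] and [ev] is evaluation; of this family the count uses only its size and
    the closure property [evP] below. *)
Definition linked_mx (x y : 'rV[K]_k) : {set 'M[K]_(k, N)} :=
  [set G | [exists i, y *m G == map_mx (ev i) (x *m G)]].

Lemma linked_mxP (x y : 'rV[K]_k) (G : 'M[K]_(k, N)) :
  reflect (exists i, y *m G = map_mx (ev i) (x *m G)) (G \in linked_mx x y).
Proof. by rewrite /linked_mx inE; apply: (iffP existsP) => -[i /eqP]; exists i. Qed.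

(** Along a coset of [w 'rV_N] the product [x *m G] is constant while [y *m G] takes each value
    once, so each index [i] singles out at most one point. *)
Lemma card_linked_mx x y : ~~ (y <= x)%MS ->
  (#|linked_mx x y| * #|K| ^ N <= #|K| ^ (k * N) * #|I|)%N.
Proof.
case/sub_rV_separate=> w xw0 yw1; set B := linked_mx x y.
have -> : (#|B| * #|K| ^ N = \sum_(z : 'rV[K]_N) \sum_(G | (G + w *m z \in B)%R) 1)%N.
  rewrite -[N in (_ ^ N)%N]mul1n -card_mx mulnC -sum_nat_const.
  apply: eq_bigr => z _; rewrite -sum1_card.
  by rewrite (reindex_inj (addIr (w *m z))).
(* Each coset G + w 'rV_N meets linked_mx x y in at most #|I| points. *)
rewrite (exchange_big_dep predT) //= -card_mx -sum_nat_const; apply: leq_sum => G _.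
pose f i := map_mx (ev i) (x *m G) - y *m G.
rewrite sum1_card -[#|I|]cardsT; apply: leq_trans (leq_imset_card f _).
apply/subset_leq_card/subsetP=> z.
rewrite unfold_in => /linked_mxP[i].
rewrite !mulmxDr !mulmxA xw0 yw1 mul0mx addr0 mul1mx => h.
by apply/imsetP; exists i; rewrite ?inE // /f -h addrC addKr.
Qed.

Lemma exists_linked_dependent_mx :
    (2 < #|K|)%N -> (#|I| * #|K| ^ (2 * k) <= #|K| ^ N.+2)%N ->
    (forall i l u v, exists j, forall a, ev j a = u * ev i (l * a) + v * a) ->
  exists G : 'M[K]_(k, N), forall (x y : 'rV[K]_k) i, x != 0 ->
    y *m G = map_mx (ev i) (x *m G) -> (y <= x)%MS.
Proof.
set Q := #|K| => Q_gt2 cardI evP.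
pose ind (p : 'rV[K]_k * 'rV[K]_k) := (p.1 != 0) && ~~ (p.2 <= p.1)%MS.
have [/existsP[G /forallP hG]|noG] := boolP [exists G : 'M[K]_(k, N),
    [forall p, ind p ==> (G \notin linked_mx p.1 p.2)]].
  exists G => x y i x0 yG; apply: contraT => xy.
  have := hG (x, y); rewrite /ind /= x0 xy => /negP[].
  by apply/linked_mxP; exists i.
exfalso; pose bad G := [set p | ind p & G \in linked_mx p.1 p.2].
(* If every [G] has a bad pair, its multiples (l x, u y + v x) with l and u nonzero are distinct bad
   pairs. *)
have lower G : ((Q - 1) * ((Q - 1) * Q) <= #|bad G|)%N.
  move: noG; rewrite negb_exists => /forallP/(_ G).
  rewrite negb_forall => /existsP[[x y]]; rewrite negb_imply negbK /ind /=.
  case/andP=> /andP[x0 xy] /linked_mxP[i yG].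
  pose f (s : K * (K * K)) := (s.1 *: x, s.2.1 *: y + s.2.2 *: x).
  pose S := setX [set~ 0 : K] (setX [set~ 0 : K] [set: K]).
  have -> : ((Q - 1) * ((Q - 1) * Q) = #|S|)%N.
    by rewrite !cardsX !cardsC1 cardsT subn1.
  have injf : {in S &, injective f}.
    have eqx a b : a *: x = b *: x -> a = b.
      move/eqP; rewrite -subr_eq0 -scalerBl scaler_eq0 (negPf x0) orbF.
      by rewrite subr_eq0 => /eqP.
    move=> [l [u v]] [l' [u' v']] _ _; rewrite /f /= => -[/eqx-> h].
    have /eqP : (u - u') *: y = (v' - v) *: x.
      by rewrite !scalerBl; apply/eqP; rewrite subr_eq addrAC -subr_eq opprK h addrC.
    have [->|uu'] := eqVneq u u'.
      rewrite subrr scale0r eq_sym scaler_eq0 (negPf x0) orbF subr_eq0.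
      by move=> /eqP ->.
    move=> /eqP h'; case/negP: xy; apply/sub_rVP; exists ((u - u')^-1 * (v' - v)).
    by rewrite -scalerA -h' scalerA mulVf ?subr_eq0 // scale1r.
  rewrite -(card_in_imset injf); apply/subset_leq_card/subsetP.
  move=> _ /imsetP[[l [u v]] + ->].
  rewrite in_setX /= in_setX /= in_setT !in_setC1 andbT => /andP[l0 u0].
  rewrite in_set /ind /= scaler_eq0 negb_or l0 x0 /=.
  apply/andP; split.
    apply: contra xy => /sub_rVP[a ha]; apply/sub_rVP.
    exists (u^-1 * (a * l - v)); rewrite -scalerA scalerBl -scalerA -ha addrK.
    by rewrite scalerA mulVf // scale1r.
  (* The map a |-> u phi(a / l) + (v / l) a sends l c to u phi(c) + v c. *)
  apply/linked_mxP; have [j hj] := evP i l^-1 u (v / l); exists j.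
  rewrite mulmxDl -!scalemxAl yG; set c := x *m G; apply/matrixP=> a b.
  by rewrite !mxE hj mulKf // -mulrA mulKf.
(* The same incidences summed over the Q^(2k) pairs, each bounded by [card_linked_mx]. *)
have upper : (\sum_(G : 'M[K]_(k, N)) #|bad G| * Q ^ N <=
    Q ^ (2 * k) * (Q ^ (k * N) * #|I|))%N.
  have -> : (Q ^ (2 * k) = #|{: 'rV[K]_k * 'rV[K]_k}|)%N.
    by rewrite card_prod card_mx mul1n mul2n -addnn expnD.
  rewrite -big_distrl /= -sum_nat_const.
  under eq_bigr => G _ do rewrite -sum1_card.
  rewrite (exchange_big_dep predT) //= big_distrl /=; apply: leq_sum => p _.
  have [xy|/negP xy] := boolP (ind p); last first.
    by rewrite big_pred0 // => G; rewrite inE; apply/andP => -[].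
  have /andP[_ /card_linked_mx] := xy; apply: leq_trans.
  rewrite leq_mul2r; apply/orP; right.
  rewrite -sum1_card; apply: eq_leq; apply: eq_bigl => G.
  by rewrite inE xy.
have : (Q ^ (k * N) * ((Q - 1) * ((Q - 1) * Q) * Q ^ N) <= Q ^ (k * N) * Q ^ N.+2)%N.
  apply: leq_trans (_ : _ <= Q ^ (k * N) * (#|I| * Q ^ (2 * k)))%N _; last first.
    by rewrite leq_mul2l cardI orbT.
  rewrite mulnCA [(#|I| * _)%N]mulnC mulnCA in upper *.
  apply: leq_trans upper; rewrite -card_mx -sum_nat_const.
  by apply: leq_sum => G _; rewrite leq_mul2r lower orbT.
have Q0 : (0 < Q)%N by lia.
rewrite leq_pmul2l ?expn_gt0 ?Q0 // !expnS !mulnA leq_pmul2r ?expn_gt0 ?Q0 //.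
(* What remains is (Q - 1)^2 <= Q, which fails exactly because Q >= 3. *)
rewrite leq_pmul2r //; nia.
Qed.

End Counting.

(** * One block over L, and the passage from supports to linear maps *)

Section RankMetric.

Variables (F : finFieldType) (L : fieldExtType F).
Implicit Types (k N : nat).

Definition rank_minimal k N (G : 'M[L]_(k, N)) : Prop :=
  forall (x y : 'rV[L]_k) (phi : 'End(L)),
  y *m G = map_mx phi (x *m G) -> exists a, y = a *: x.

Lemma card_finvect (vT : vectType F) :
  #|{: finvect_type vT}| = (#|F| ^ \dim {:vT})%N.
Proof.
rewrite -(@card_vspacef F (finvect_type vT) (Vector.class vT)); exact: card_vspace.
Qed.

Lemma exists_rank_minimal k N : (1 < k)%N -> (1 < \dim {:L})%N ->
    N.+2 = (2 * k + \dim {:L})%N ->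
  exists G : 'M[L]_(k, N), rank_minimal G.
Proof.
move=> k_gt1 m_gt1 defN; pose K : finFieldType := finvect_type L.
pose I : finType := finvect_type 'End(L).
have cardK : #|K| = (#|F| ^ \dim {:L})%N := card_finvect L.
(* ['End(L)] has dimension m^2 over F, and #|F|^(m^2) = Q^m. *)
have cardI : #|I| = (#|K| ^ \dim {:L})%N.
  by rewrite [LHS]card_finvect cardK -expnM !dimvf.
have F_gt1 : (1 < #|F|)%N := finNzRing_gt1 F.
have K_gt2 : (2 < #|K|)%N.
  rewrite cardK; apply: (@leq_trans (2 ^ 2)) => //.
  by apply: leq_trans (leq_pexp2l _ m_gt1) _; rewrite // leq_exp2r // ltnW.
pose ev (phi : 'End(L)) a := phi a.
have [||i l u v|G hG] := @exists_linked_dependent_mx K I ev k N => //.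
- by rewrite cardI -expnD addnC -defN.
- exists (amulr u \o i \o amulr l + amulr v)%VF => a; rewrite /ev.
  rewrite !lfunE /= !lfunE /= !lfunE /= lfunE /=.
  by rewrite [a * v]mulrC [a * l]mulrC [X in X + _]mulrC.
have {}hG (x y : 'rV[L]_k) (phi : 'End(L)) : x != 0 ->
    y *m G = map_mx phi (x *m G) -> exists a, y = a *: x.
  by move=> x0 /hG -/(_ x0) /sub_rVP.
exists G => x y phi yG; have [x0|] := eqVneq x 0; last first.
  by move=> nx0; exact: (hG x y phi nx0 yG).
have yG0 : y *m G = 0 by rewrite yG x0 mul0mx; apply/matrixP=> a b; rewrite !mxE linear0.
(* For x = 0, the zero map links every unit vector to [y]; being a multiple of two different unit
   vectors, [y] vanishes. This is where k >= 2 enters. *)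
have yE (j : 'I_k) : exists a, y = a *: delta_mx 0 j.
  apply: (hG _ _ 0); first by apply/rV0Pn; exists j; rewrite mxE !eqxx oner_eq0.
  by rewrite yG0; apply/matrixP=> a b; rewrite !mxE lfunE.
have [a ya] := yE (Ordinal (ltnW k_gt1)); have [b yb] := yE (Ordinal k_gt1).
exists 0; rewrite scale0r; apply/rowP=> j; have [j0|j0] := eqVneq (j : nat) 0%N.
  have jF : j != Ordinal k_gt1 by rewrite -val_eqE /= j0.
  by rewrite yb !mxE (negPf jF) andbF mulr0.
have jF : j != Ordinal (ltnW k_gt1) by rewrite -val_eqE.
by rewrite ya !mxE (negPf jF) andbF mulr0.
Qed.

(** Take the first [N] vectors of a basis of [vT] that begins with a basis of the span of [X]. *)
Lemma extend_to_free (vT : vectType F) (X : seq vT) N :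
    (size X <= N)%N -> (N <= \dim {:vT})%N ->
  exists2 Y : N.-tuple vT, free Y & (<<X>> <= <<Y>>)%VS.
Proof.
move=> leXN leN; set W := <<X>>%VS; pose Z := vbasis W ++ vbasis W^C.
have freeZ : free Z.
  rewrite cat_free !(basis_free (vbasisP _)) /= !(span_basis (vbasisP _)).
  by rewrite directv_addE /= !directv_trivial capv_compl eqxx.
have sizeZ : size Z = \dim {:vT}.
  by rewrite -(eqnP freeZ) span_cat !(span_basis (vbasisP _)) addv_complf.
have tN : size (take N Z) == N by rewrite size_takel // sizeZ.
exists (Tuple tN) => /=.
  by apply: (@catl_free _ _ (drop N Z)); rewrite cat_take_drop.
have leW : (\dim W <= N)%N := leq_trans (dim_span X) leXN.
rewrite -[W in (W <= _)%VS](span_basis (vbasisP W)); apply: sub_span => v vW.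
by rewrite take_cat size_tuple ltnNge leW mem_cat vW.
Qed.

Lemma column_mul k N (G : 'M[L]_(k, N)) (B : 'M[F]_N) j :
  column (G *m map_mx (in_alg L) B) j = \sum_i B i j *: column G i.
Proof.
apply/ffunP=> r; rewrite sum_ffunE !ffunE mxE; apply: eq_bigr => i _.
by rewrite !ffunE mxE mulrC mulr_algl.
Qed.

Lemma column_inj k N (G H : 'M[L]_(k, N)) : column G =1 column H -> G = H.
Proof. by move=> GH; apply/matrixP=> r j; have /ffunP/(_ r) := GH j; rewrite !ffunE. Qed.

(** An F-linear [phi] commutes with right multiplication by a matrix over F. *)
Lemma rank_minimal_mul k N (G : 'M[L]_(k, N)) (B : 'M[F]_N) :
  rank_minimal (G *m map_mx (in_alg L) B) -> rank_minimal G.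
Proof.
move=> minGB x y phi yG; apply: (minGB x y phi); rewrite !mulmxA yG.
apply/matrixP=> a b; rewrite [LHS]mxE [RHS]mxE mxE linear_sum /=; apply: eq_bigr => i _.
by rewrite !mxE ![_ * _%:A]mulrC !mulr_algl linearZ.
Qed.

Lemma dim_ffun_fieldExt k : \dim {:{ffun 'I_k -> L}} = (\dim {:L} * k)%N.
Proof. by rewrite !dimvf /dim /= card_ord mulnC. Qed.

(** The bound is the F-dimension of L^k, so there is room for [N] independent columns whose span
    contains those of [G]; then G = H B with B over F. *)
Lemma columns_free_extend k N (G : 'M[L]_(k, N)) : (N <= \dim {:L} * k)%N ->
  exists2 H : 'M[L]_(k, N), columns_free H & rank_minimal G -> rank_minimal H.
Proof.
rewrite -dim_ffun_fieldExt => leN.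
have [|Y freeY GY] := @extend_to_free _ [seq column G j | j : 'I_N] N _ leN.
  by rewrite size_image card_ord.
pose H := \matrix_(r < k, j < N) Y`_j r.
have colH j : column H j = Y`_j by apply/ffunP=> r; rewrite ffunE mxE.
exists H.
  rewrite /columns_free; congr (free _): freeY.
  apply: (@eq_from_nth _ 0) => [|i]; rewrite size_tuple ?size_image ?card_ord // => ltiN.
  by rewrite (nth_map (Ordinal ltiN)) ?size_enum_ord // colH nth_enum_ord.
pose B := \matrix_(i, j) coord Y i (column G j).
suff -> : G = H *m map_mx (in_alg L) B by exact: rank_minimal_mul.
apply: column_inj => j; rewrite column_mul.
rewrite [LHS](coord_span (X := Y)); last first.
  by apply/(subvP GY)/memv_span/image_f.
by apply: eq_bigr => i _; rewrite mxE colH.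
Qed.

(** Inclusion of column spaces means Gamma(u) = Gamma(v) D. The rows of [Gamma] are the coordinates
    of the entries, so [D] is the matrix of the desired [phi]. *)
Lemma srk_supp_le_linear t (n : 'I_t -> nat) (c' c : 'rV[L]_(\sum_i n i)) i :
  srk_supp_le c' c ->
  exists phi : 'End(L), submxrow c' i = map_mx phi (submxrow c i).
Proof.
move=> /(_ i); rewrite /srk_supp; set u := submxrow c' i; set v := submxrow c i.
rewrite /colsp => le_uv; set b := vbasis {:L}.
pose X := [tuple col l (Gamma v) | l < \dim {:L}].
pose D := \matrix_(l', l) coord X l' (col l (Gamma u)).
exists (hommx b b D); apply/rowP=> j; rewrite [RHS]mxE.
apply: (can_inj (rVofK (vbasisP {:L}))); rewrite -rVof_mul ?vbasisP //.
apply/rowP=> l; have : col l (Gamma u) \in <<X>>%VS.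
  by apply: (subvP le_uv); apply/memv_span/image_f.
move/coord_span/colP/(_ j); rewrite !mxE summxE => uE.
rewrite uE; apply: eq_bigr => l' _.
by rewrite -tnth_nth tnth_mktuple !mxE mulrC.
Qed.

Lemma span_rows_mulmx k p (G : 'M[L]_(k, p)) c :
  c \in <<[seq row r G | r : 'I_k]>>%VS -> exists x, c = x *m G.
Proof.
move/(coord_span (X := [tuple row r G | r < k])) => cE.
exists (\row_r coord [tuple row r G | r < k] r c).
rewrite {1}cE mulmx_sum_row; apply: eq_bigr => r _.
by rewrite -tnth_nth tnth_mktuple mxE.
Qed.

Lemma free_rows k p (G : 'M[L]_(k, p)) :
  (forall x : 'rV_k, x *m G = 0 -> x = 0) -> free [seq row r G | r : 'I_k].
Proof.
move=> injG; apply/(freeP (X := [tuple row r G | r < k])) => a sum0 r.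
have /rowP/(_ r) : \row_r a r = 0; last by rewrite !mxE.
apply: injG; rewrite mulmx_sum_row -[RHS]sum0; apply: eq_bigr => j _.
by rewrite -tnth_nth tnth_mktuple mxE.
Qed.

Lemma rank_minimal_inj k N (G : 'M[L]_(k, N)) :
  rank_minimal G -> forall x : 'rV_k, x *m G = 0 -> x = 0.
Proof.
move=> minG x xG; have [|a ->] := minG 0 x 0; last exact: scaler0.
by rewrite xG mul0mx; apply/matrixP=> i j; rewrite !mxE linear0.
Qed.

(** The definition wants [\dim C] rows, equal to [k] only propositionally; generalizing over [k]
    lets the equation be eliminated. *)
Lemma generator_nondegenerate t (n : 'I_t -> nat) k
    (G : 'M[L]_(k, \sum_i n i)) (C : {vspace 'rV[L]_(\sum_i n i)}) :
  \dim C = k -> generator_matrix C G ->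
  (forall i, columns_free (submxrow G i)) -> srk_nondegenerate C.
Proof. by move=> dimC; case: _ / dimC G => G; exists G. Qed.

End RankMetric.

(** * Assembling the blocks into a code *)

Theorem proposition2p11 (q m k t : nat) (F : finFieldType)
    (L : fieldExtType F) (n : 'I_t -> nat)
    (hq : #|F| = q) (hL : \dim {:L} = m)
    (hm : (2 <= m)%N) (hk : (2 <= k)%N) (ht : (1 <= t)%N)
    (hn1 : forall i : 'I_t, i = 0%N :> nat -> n i = (2 * k + m - 2)%N)
    (hn : forall i : 'I_t, i <> 0%N :> nat -> (0 < n i <= m * k)%N) :
  exists C : {vspace 'rV[L]_(\sum_i n i)},
    [/\ \dim C = k, srk_nondegenerate C & minimal_code C].
Proof.
have /fin_all_exists[G_ hG] (i : 'I_t) : exists G : 'M[L]_(k, n i),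
    columns_free G /\ (i = 0%N :> nat -> rank_minimal G).
  have [i0|i0] := eqVneq (i : nat) 0%N.
    have [G minG] : exists G : 'M[L]_(k, n i), rank_minimal G.
      by apply: exists_rank_minimal; rewrite ?hL ?hn1 //; lia.
    have [|H freeH minH] := @columns_free_extend F L k (n i) G.
      (* The difference mk - (2k + m - 2) is (m - 2)(k - 1) >= 0. *)
      by rewrite hL hn1 //; nia.
    by exists H; split; auto.
  (* Starting from the zero matrix yields arbitrary independent columns. *)
  have [|H freeH _] := @columns_free_extend F L k (n i) 0.
    by have /andP[_] := hn i (elimN eqP i0); rewrite hL.
  by exists H; split=> // /eqP; rewrite (negPf i0).
pose G := \mxrow_i G_ i; pose i0 := Ordinal ht.
have minG0 : rank_minimal (submxrow G i0) by rewrite mxrowK; apply: (hG i0).2.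
have injG (x : 'rV_k) : x *m G = 0 -> x = 0.
  move=> xG; apply: (rank_minimal_inj minG0); rewrite mul_submxrow xG.
  by apply/rowP=> j; rewrite !mxE.
pose C := <<[seq row r G | r : 'I_k]>>%VS.
have freeG := free_rows injG.
have dimC : \dim C = k by rewrite (eqnP freeG) size_image card_ord.
exists C; split=> //.
  apply: (generator_nondegenerate (G := G) dimC).
    by rewrite /generator_matrix basisEfree freeG subvv /= dimC size_image card_ord.
  by move=> i; rewrite mxrowK; have [] := hG i.
(* The first block already forces y = a x for the message vectors, and this relation carries over to
   the whole codewords. *)
move=> _ /span_rows_mulmx[x ->] _ /span_rows_mulmx[y ->] /(srk_supp_le_linear i0)[phi].
rewrite -!mul_submxrow => /minG0[a ->].
by exists a; rewrite scalemxAl.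
Qed.
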